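(* Suppose the component functions $f(\cdot;1),\dots,f(\cdot;n)$ satisfy $\|\nabla f(x;i)\|\le G$ and $\|\nabla f(x;i)-\nabla f(y;i)\|\le L\|x-y\|$ for all $x,y\in\mathcal W$ and $i\in[n]$, where $G,L>0$, and suppose $\mathrm{diam}(\mathcal W)\le D$. Let $x_i^k$ be the iterates of SGD without replacement run for $K$ epochs with constant step size $\alpha_{k,i}=\alpha:=\min\left(\frac2L,\frac{D}{G\sqrt{Kn}}\right)$, and let $\hat x:=\frac{1}{Kn}\sum_{i=0}^{n-1}\sum_{k=1}^K x_i^k$. Then $$\mathbb E[F(\hat x)]-F(x^* )\le\frac{D^2L}{4nK}+\frac{3GD}{\sqrt{nK}}.$$
   Context: Setting. $[n]=\{1,\dots,n\}$; $\|\cdot\|$ is the Euclidean norm on $\mathbb R^d$. $\mathcal W\subset\mathbb R^d$ is a closed convex set with Euclidean projection $\Pi_{\mathcal W}$, and $\mathrm{diam}(\mathcal W)$ is its diameter. The functions $f(\cdot;1),\dots,f(\cdot;n):\mathbb R^d\to\mathbb R$ are convex and twice differentiable, $F(x)=\frac1n\sum_{i=1}^n f(x;i)$, and $x^*$ denotes a minimizer of $F$ over $\mathcal W$. SGD without replacement (with $K$ epochs and step sizes $\alpha_{k,i}\ge0$, $1\le k\le K$, $0\le i\le n-1$). Let $\sigma_1,\dots,\sigma_K$ be independent uniformly random permutations of $[n]$. Start at $x_0^1=0$. In epoch $k$, for $i=0,1,\dots,n-1$, set $$x_{i+1}^k=\Pi_{\mathcal W}\bigl(x_i^k-\alpha_{k,i}\nabla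 f(x_i^k;\sigma_k(i+1))\bigr),$$ and set $x_0^{k+1}=x_n^k$. Expectations are over the random permutations.
   Formalization: The formal theorem additionally assumes that the starting point 0 lies in W; without this the claim fails, e.g. for W = {w} with w ≠ 0, f(x;i) = −⟨w,x⟩ and small D. *)

(* Defs.v *)
(* MathComp / MathComp-Analysis *)
From HB Require Import structures.
From mathcomp Require Import all_boot all_order all_algebra all_fingroup.
From mathcomp Require Import all_classical all_reals all_analysis.

Set Implicit Arguments.
Unset Strict Implicit.
Unset Printing Implicit Defensive.

Import Order.TTheory GRing.Theory Num.Theory.
Import numFieldNormedType.Exports.

Local Open Scope classical_set_scope.
Local Open Scope ring_scope.

Section Euclidean.
Context {R : realType} {d : nat}.
Implicit Types (W : set 'rV[R]_d) (f : 'rV[R]_d -> R) (x y : 'rV[R]_d).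

(* The library norm `|x| on 'rV[R]_d is the sup norm: it is used here only
   through the topology and differentiability, which do not depend on the choice
   of the norm. *)
Definition enorm x : R := Num.sqrt (\sum_(j < d) x 0 j ^+ 2).

(* Meaningful where [f] is differentiable. *)
Definition grad f x : 'rV[R]_d := \row_(j < d) 'D_(delta_mx 0 j) f x.

Definition twice_differentiable f : Prop :=
  (forall x, differentiable f x) /\ (forall x, differentiable (grad f) x).

Definition diam W : \bar R :=
  ereal_sup [set (enorm (p.1 - p.2))%:E | p in W `*` W].

Definition is_proj W x p : Prop :=
  W p /\ forall y, W y -> enorm (x - p) <= enorm (x - y).

(* For a nonempty closed convex [W] there is exactly one [p] such that
   [is_proj W x p]; the default value 0 is irrelevant in that case. *)
Definition proj W x : 'rV[R]_d := xget 0 [set p | is_proj W x p].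

Definition minimizer_on W f x : Prop := W x /\ forall y, W y -> f x <= f y.

End Euclidean.

Section SGD.
Context {R : realType} {d n K : nat}.
Implicit Types (x : 'rV[R]_d) (s : 'S_n).

Variables (W : set 'rV[R]_d) (f : 'I_n -> 'rV[R]_d -> R).

Definition avg_obj x : R := n%:R^-1 * \sum_(i < n) f i x.

(* The components, the epochs and the positions in a permutation are numbered
   from 0. *)
Variable alpha : 'I_K -> 'I_n -> R.
Variable sigma : {ffun 'I_K -> 'S_n}.

(* [i] steps of an epoch with step sizes [a] and permutation [s], started at
   [x]; there is no step beyond the [n]-th. *)
Fixpoint sgd_epoch (a : 'I_n -> R) s x (i : nat) : 'rV[R]_d :=
  if i is i'.+1 then
    let y := sgd_epoch a s x i' in
    if insub i' is Some j then proj W (y - a j *: grad (f (s j)) y) else y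
  else x.

Fixpoint sgd_start (k : nat) : 'rV[R]_d :=
  if k is k'.+1 then
    let y := sgd_start k' in
    if insub k' is Some l then sgd_epoch (alpha l) (sigma l) y n else y
  else 0.

(* The iterate x_i^(k+1), for 0 <= i <= n. *)
Definition sgd_iter (k : 'I_K) (i : nat) : 'rV[R]_d :=
  sgd_epoch (alpha k) (sigma k) (sgd_start k) i.

Definition sgd_average : 'rV[R]_d :=
  (K * n)%:R^-1 *: \sum_(i < n) \sum_(k < K) sgd_iter k i.

Lemma sgd_iter_first (k : 'I_K) : k = 0%N :> nat -> sgd_iter k 0 = 0.
Proof. by rewrite /sgd_iter /= => ->. Qed.

Lemma sgd_iterS (k : 'I_K) (i : 'I_n) :
  sgd_iter k i.+1 =
  proj W (sgd_iter k i - alpha k i *: grad (f (sigma k i)) (sgd_iter k i)).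
Proof. by rewrite /sgd_iter /= valK. Qed.

Lemma sgd_iter_next (k l : 'I_K) :
  l = k.+1 :> nat -> sgd_iter l 0 = sgd_iter k n.
Proof. by rewrite /sgd_iter /= => ->; rewrite /= valK. Qed.

End SGD.

(* Expectation over K independent uniformly random permutations, i.e. over a
   uniformly random element of the K-fold product of 'S_n. *)
Definition expect_perms {R : realType} {n K : nat}
    (X : {ffun 'I_K -> 'S_n} -> R) : R :=
  (\sum_sigma X sigma) / #|{: {ffun 'I_K -> 'S_n}}|%:R.

(* Main.v *)
(* With z the minimizer, expanding |x_{i+1} - z|^2 and summing over all steps
   bounds the sum of f_{sigma(i+1)}(x_i) - f_{sigma(i+1)}(z).
   To replace f_{sigma(i+1)}(x_i) by F(x_i) in expectation, exchange positions
   i+1 and j of the permutation, for a uniform j: this preserves its law and puts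
   a uniform component at position i+1, while the iterate x_i moves by at most
   2 alpha G, since the projected steps are nonexpansive for alpha <= 2/L and
   only one of the first i steps differs.  The replacement thus costs at most
   2 alpha G^2 per step.

   Nonexpansiveness is delicate because the gradients are L-Lipschitz only on W,
   whereas the usual proof of cocoercivity evaluates f at points that may leave W.
   At points of the relative interior of W these evaluations stay in W if the two
   points are close enough, once gradients are projected orthogonally onto the
   span of W (which does not affect the projection onto W).  Locally nonexpansive
   maps are nonexpansive along segments, and the boundary of W is reached by
   moving both points slightly towards a relative interior point. *)

Require Import Defs.
From HB Require Import structures.
From mathcomp Require Import all_boot all_order all_algebra all_fingroup.
From mathcomp Require Import all_classical all_reals all_analysis.
From mathcomp Require Import ring lra.

Set Implicit Arguments.
Unset Strict Implicit.
Unset Printing Implicit Defensive.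

Import Order.TTheory GRing.Theory Num.Theory.
Import numFieldNormedType.Exports.

Local Open Scope classical_set_scope.
Local Open Scope ring_scope.

(** * Euclidean inner product and norm *)

Section InnerProduct.
Context {R : realType} {d : nat}.
Implicit Types (x y z : 'rV[R]_d).

Definition dot x y : R := \sum_(j < d) x 0 j * y 0 j.

Lemma dotC x y : dot x y = dot y x.
Proof. by apply: eq_bigr => j _; rewrite mulrC. Qed.

Lemma dotDl x y z : dot (x + y) z = dot x z + dot y z.
Proof. by rewrite -big_split; apply: eq_bigr => j _; rewrite mxE mulrDl. Qed.

Lemma dotZl a x y : dot (a *: x) y = a * dot x y.
Proof. by rewrite mulr_sumr; apply: eq_bigr => j _; rewrite mxE mulrA. Qed.

Lemma dotDr x y z : dot z (x + y) = dot z x + dot z y.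
Proof. by rewrite dotC dotDl !(dotC z). Qed.

Lemma dotZr a x y : dot x (a *: y) = a * dot x y.
Proof. by rewrite dotC dotZl dotC. Qed.

Lemma dotNl x y : dot (- x) y = - dot x y.
Proof. by rewrite -scaleN1r dotZl mulN1r. Qed.

Lemma dotNr x y : dot x (- y) = - dot x y.
Proof. by rewrite dotC dotNl dotC. Qed.

Lemma dot0l x : dot 0 x = 0.
Proof. by rewrite -(scale0r 0) dotZl mul0r. Qed.

Lemma dot_sumr (I : Type) (r : seq I) (F : I -> 'rV[R]_d) x :
  dot x (\sum_(i <- r) F i) = \sum_(i <- r) dot x (F i).
Proof. by elim/big_rec2: _ => [|i a b _ <-]; rewrite ?dotDr // dotC dot0l. Qed.

Lemma dot_mulmx x y : dot x y = (x *m y^T) 0 0.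
Proof. by rewrite mxE; apply: eq_bigr => j _; rewrite mxE. Qed.

Definition dotE := (dotDl, dotDr, dotNl, dotNr, dotZl, dotZr).

Lemma dotBB x y : dot (x - y) (x - y) = dot x x - 2 * dot x y + dot y y.
Proof. by rewrite !dotE (dotC y x); ring. Qed.

Lemma dot_ge0 x : 0 <= dot x x.
Proof. by apply: sumr_ge0 => j _; rewrite -expr2 sqr_ge0. Qed.

Lemma enorm_dot x : enorm x = Num.sqrt (dot x x).
Proof. by congr Num.sqrt; apply: eq_bigr => j _; rewrite expr2. Qed.

Lemma sqr_enorm x : enorm x ^+ 2 = dot x x.
Proof. by rewrite enorm_dot sqr_sqrtr ?dot_ge0. Qed.

Lemma enorm_ge0 x : 0 <= enorm x.
Proof. exact: sqrtr_ge0. Qed.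

Lemma enorm_le x a : 0 <= a -> dot x x <= a ^+ 2 -> enorm x <= a.
Proof. by move=> a0; rewrite -sqr_enorm ler_pXn2r // nnegrE ?enorm_ge0. Qed.

Lemma dot_eq0 x : dot x x = 0 -> x = 0.
Proof.
move=> /eqP; rewrite psumr_eq0 => [/allP x0|j _]; last by rewrite -expr2 sqr_ge0.
apply/rowP => j; rewrite mxE.
by have := x0 j (mem_index_enum _); rewrite mulf_eq0 orbb => /eqP.
Qed.

Lemma enorm_eq0 x : enorm x <= 0 -> x = 0.
Proof.
move=> x0; apply: dot_eq0; rewrite -sqr_enorm.
by have -> : enorm x = 0; [apply/eqP; rewrite eq_le x0 enorm_ge0 | rewrite expr0n].
Qed.

Lemma enorm0 : enorm (0 : 'rV[R]_d) = 0.
Proof. by rewrite enorm_dot dot0l sqrtr0. Qed.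

Lemma enormZ a x : enorm (a *: x) = `|a| * enorm x.
Proof.
by rewrite enorm_dot !dotE mulrA -expr2 sqrtrM ?sqr_ge0 // sqrtr_sqr enorm_dot.
Qed.

Lemma enormN x : enorm (- x) = enorm x.
Proof. by rewrite -scaleN1r enormZ normrN1 mul1r. Qed.

Lemma CauchySchwarz_dot x y : dot x y <= enorm x * enorm y.
Proof.
have [y0|yN0] := eqVneq (dot y y) 0.
  by rewrite (dot_eq0 y0) enorm0 mulr0 dotC dot0l.
have ypos : 0 < dot y y by rewrite lt_def yN0 dot_ge0.
apply: le_trans (ler_norm _) _.
rewrite -ler_sqr ?nnegrE ?normr_ge0 ?mulr_ge0 ?enorm_ge0 //.
rewrite real_normK ?num_real // exprMn !sqr_enorm.
(* This square equals [dot y y] times [dot x x * dot y y - dot x y ^+ 2]. *)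
have := dot_ge0 (dot y y *: x - dot x y *: y); rewrite !dotE (dotC y x).
move: (dot x x) (dot x y) (dot y y) ypos => a b c c0 H.
have : 0 <= c * (a * c - b ^+ 2) by apply: le_trans H _; lra.
by rewrite pmulr_rge0 // subr_ge0.
Qed.

Lemma ler_enormD x y : enorm (x + y) <= enorm x + enorm y.
Proof.
apply: enorm_le; first by rewrite addr_ge0 ?enorm_ge0.
rewrite !dotE (dotC y x) -!sqr_enorm; have := CauchySchwarz_dot x y; nra.
Qed.

Lemma ler_enormB x y : enorm (x - y) <= enorm x + enorm y.
Proof. by rewrite -(enormN y) ler_enormD. Qed.

Lemma coord_le_enorm x j : `|x 0 j| <= enorm x.
Proof.
rewrite -sqrtr_sqr; apply: ler_wsqrtr.
by rewrite (bigD1 j) //= lerDl sumr_ge0 // => i _; rewrite sqr_ge0.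
Qed.

Lemma enorm_continuous : continuous (@enorm R d).
Proof.
move=> x; apply: (continuous_comp (g := Num.sqrt)); last exact: sqrt_continuous.
apply: continuous_big => [|j _ y]; first exact: add_continuous.
apply: (@continuous_comp _ _ _ (fun x : 'rV[R]_d => x 0 j) (fun a : R => a ^+ 2)).
  exact: coord_continuous.
exact: exprn_continuous.
Qed.

End InnerProduct.

Lemma enorm_le_diam {R : realType} {d : nat} (W : set 'rV[R]_d) (D : R) x y :
  (diam W <= D%:E)%E -> W x -> W y -> enorm (x - y) <= D.
Proof.
move=> WD Wx Wy; rewrite -lee_fin; apply: le_trans WD.
by apply: ereal_sup_ubound; exists (x, y).
Qed.

(** * Projection onto a convex set *)

Section Projection.
Context {R : realType} {d : nat}.
Variable W : set 'rV[R]_d.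
Hypothesis W_convex : convex_set W.

Lemma convex_setP x y (t : R) :
  0 <= t <= 1 -> W x -> W y -> W (t *: x + (1 - t) *: y).
Proof.
move=> t01 Wx Wy.
have /= := W_convex (Itv01 (proj1 (andP t01)) (proj2 (andP t01)))
  (mem_set Wx) (mem_set Wy).
by rewrite inE.
Qed.

(** Moving from [p] towards [y] by a fraction [t] stays in [W] and cannot bring the point closer to
    [x]; the term of first order in [t] decides the sign. *)
Lemma is_proj_dot x p y : is_proj W x p -> W y -> dot (x - p) (y - p) <= 0.
Proof.
move=> [Wp pmin] Wy.
have step t : 0 < t -> t <= 1 ->
    2 * dot (x - p) (y - p) <= t * dot (y - p) (y - p).
  move=> t0 t1; have t01 : 0 <= t <= 1 by rewrite ltW.
  have := pmin _ (convex_setP t01 Wy Wp).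
  rewrite -ler_sqr ?nnegrE ?enorm_ge0 // !sqr_enorm.
  have -> : x - (t *: y + (1 - t) *: p) = (x - p) - t *: (y - p).
    by apply/rowP => j; rewrite !mxE; ring.
  rewrite [X in _ <= X](_ : _ = dot (x - p) (x - p)
     - t * (2 * dot (x - p) (y - p) - t * dot (y - p) (y - p))); last first.
    by rewrite (dotBB (x - p)) dotZl !dotZr; ring.
  rewrite lerBrDl gerDr pmulr_rle0 // subr_le0 //.
rewrite leNgt; apply/negP => c0.
have q0 := dot_ge0 (y - p).
have := step _ ltr01 (lexx _); rewrite mul1r => cq.
have qpos : 0 < dot (y - p) (y - p) by lra.
(* For this [t], which the case [t = 1] shows to be at most 1, [step] would bound twice a positive
   number by that number. *)
have := step (dot (x - p) (y - p) / dot (y - p) (y - p)).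
rewrite divfK ?gt_eqF // divr_gt0 // ler_pdivrMr // mul1r.
by move=> /(_ isT); lra.
Qed.

(** Sum of the variational inequalities [is_proj_dot] of [p] tested at [q] and of [q] tested at
    [p]. *)
Lemma is_proj_firmly_nonexpansive x y p q : is_proj W x p -> is_proj W y q ->
  dot (p - q) (p - q) <= dot (x - y) (p - q).
Proof.
move=> px qy.
have := is_proj_dot px (proj1 qy); have := is_proj_dot qy (proj1 px).
by rewrite !dotE (dotC q p); lra.
Qed.

Lemma is_proj_nonexpansive x y p q : is_proj W x p -> is_proj W y q ->
  enorm (p - q) <= enorm (x - y).
Proof.
move=> xp yq; have := is_proj_firmly_nonexpansive xp yq.
move=> /le_trans /(_ (CauchySchwarz_dot _ _)); rewrite -sqr_enorm expr2.
have [->|pqN0] := eqVneq (enorm (p - q)) 0; first by rewrite enorm_ge0.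
by rewrite ler_pM2r // lt_def pqN0 enorm_ge0.
Qed.

(** A finite diameter makes the closed set [W] compact, so the distance to [x] attains its minimum
    and [xget] does not return its default. *)
Lemma is_proj_proj (D : R) x : closed W -> W !=set0 -> (diam W <= D%:E)%E ->
  is_proj W x (Defs.proj W x).
Proof.
move=> Wcl [w Ww] Wdiam.
suff [p px] : exists p, is_proj W x p
  by exact: (@xgetPex _ 0 [set p | is_proj W x p] (ex_intro _ p px)).
have Wcpt : compact W.
  apply: bounded_closed_compact => //.
  exists (D + enorm w); split; first exact: num_real.
  move=> M DM v Wv /=; apply: le_trans (ltW DM).
  rewrite [`|v|]/Num.norm /= mx_normrE.
  apply: bigmax_le => [|[i j] _ /=].
    by rewrite addr_ge0 ?enorm_ge0 // (le_trans (enorm_ge0 (w - w)))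
      ?(enorm_le_diam Wdiam).
  rewrite ord1.
  apply: le_trans (coord_le_enorm _ _) _.
  rewrite -[v](subrK w); apply: le_trans (ler_enormD _ _) _.
  by rewrite lerD2r (enorm_le_diam Wdiam).
have cont : {within W, continuous (fun v => enorm (x - v))}.
  apply: continuous_subspaceT => v.
  have sub : {for v, continuous (fun v : 'rV[R]_d => x - v)}.
    by apply: (@continuousB _ _ _ (cst x) id) => //; exact: cst_continuous.
  by have := continuous_comp sub (@enorm_continuous R d (x - v)).
have [p Wp pmin] := EVT_min_rV (ex_intro _ w Ww) Wcpt cont.
by exists p; split=> [|y Wy]; [rewrite -inE | apply: pmin; rewrite inE].
Qed.

End Projection.

(** * First-order inequalities for convex and for smooth functions *)

Section Gradient.
Context {R : realType} {d : nat}.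
Implicit Types (f : 'rV[R]_d -> R) (x y v : 'rV[R]_d).

Lemma grad_dot f x v : differentiable f x -> 'D_v f x = dot (grad f x) v.
Proof.
move=> df; rewrite deriveE // [in LHS](row_sum_delta v) linear_sum.
by apply: eq_bigr => j _; rewrite linearZ /= mxE deriveE // mulrC.
Qed.

Lemma is_derive_line f x v (t : R) : differentiable f (x + t *: v) ->
  is_derive t 1 (fun s : R => f (x + s *: v)) (dot (grad f (x + t *: v)) v).
Proof.
move=> df; rewrite -grad_dot //.
have E : (fun h : R => h^-1 *: (((fun s : R => f (x + s *: v)) \o shift t) (h *: 1)
      - f (x + t *: v)))
    = (fun h => h^-1 *: ((f \o shift (x + t *: v)) (h *: v) - f (x + t *: v))).
  apply/funext => h /=; congr (_ *: (f _ - _)).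
  by rewrite [h *: 1]mulr1 scalerDl addrCA.
split; first by rewrite /derivable E; exact: diff_derivable.
by rewrite /derive E.
Qed.

(** By convexity, the difference quotient at [x] in direction [y - x] is at most [f y - f x] for
    steps in (0, 1); let the step tend to 0 from the right. *)
Lemma convex_ge_tangent f x y : convex_function setT f -> differentiable f x ->
  f x + dot (grad f x) (y - x) <= f y.
Proof.
move=> fc df; rewrite -lerBrDl -grad_dot // /derive.
have cv : cvg (h^-1 *: (f (h *: (y - x) + x) - f x) @[h --> 0^']).
  exact: diff_derivable.
rewrite cvg_at_rightE //; apply: limr_le.
  by apply/cvg_ex; exists (lim (h^-1 *: (f (h *: (y - x) + x) - f x) @[h --> 0^']));
    exact: cvg_dnbhs_at_right.
near=> h.
have h0 : 0 < h by near: h; exact: nbhs_right_gt.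
have h1 : h < 1 by near: h; exact: nbhs_right_lt.
have fh : f (h *: y + (1 - h) *: x) <= h * f y + (1 - h) * f x :=
  @fc (Itv01 (ltW h0) (ltW h1)) y x (in_setT _) (in_setT _).
have E : h *: (y - x) + x = h *: y + (1 - h) *: x.
  by apply/rowP => j; rewrite !mxE; ring.
rewrite /= E [_ *: _]mulrC ler_pdivrMr //.
by apply: le_trans (lerB fh (lexx _)) _; lra.
Unshelve. all: by end_near.
Qed.

(** The Lipschitz bound is asked only along the segment, so that it can be applied to segments
    inside [W]. *)
Lemma lipschitz_grad_descent f (L : R) x v :
  (forall z, differentiable f z) ->
  (forall t : R, 0 <= t <= 1 ->
    enorm (grad f (x + t *: v) - grad f x) <= L * enorm (t *: v)) ->
  f (x + v) <= f x + dot (grad f x) v + L / 2 * dot v v.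
Proof.
move=> df Lip.
(* The claim reads [phi 1 <= phi 0]; the mean value theorem reduces it to the sign of the derivative
   [dphi]. *)
pose phi (t : R) := f (x + t *: v) - (t * dot (grad f x) v + t ^+ 2 * (L / 2 * dot v v)).
pose dphi (t : R) := dot (grad f (x + t *: v)) v - (dot (grad f x) v + t * (L * dot v v)).
have dphiP (t : R) : is_derive t 1 phi (dphi t).
  apply: is_deriveB; first exact: is_derive_line.
  have -> : (fun s : R => s * dot (grad f x) v + s ^+ 2 * (L / 2 * dot v v))
      = dot (grad f x) v *: id + (L / 2 * dot v v) *: id ^+ 2.
    by apply/funext => s; rewrite /= mulrC [_ * (_ / _ * _)]mulrC.
  apply: (is_derive_eq (is_deriveD (is_deriveZ _ (is_derive_id t 1))
    (is_deriveZ _ (is_deriveX 2 (is_derive_id t 1))))).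
  rewrite /= expr1 [_ *: 1]mulr1.
  transitivity (dot (grad f x) v + L / 2 * dot v v * (2 * t * 1)) => //.
  by move: (dot v v) (dot _ _) => q a; field.
have [c c01 phi1] : exists2 c : R, c \in `]0, 1[ & phi 1 - phi 0 = dphi c * (1 - 0).
  apply: MVT => //; apply: derivable_within_continuous => t _.
  by have [] := dphiP t.
have c0 : 0 <= c <= 1 by move: c01; rewrite in_itv /= => /andP[? ?]; rewrite !ltW.
have dphic : dphi c <= 0.
  rewrite /dphi opprD addrA subr_le0 -dotNl -dotDl.
  apply: le_trans (CauchySchwarz_dot _ _) _.
  rewrite -sqr_enorm; have := Lip _ c0; rewrite enormZ ger0_norm ?(proj1 (andP c0)) //.
  by move=> /(ler_wpM2r (enorm_ge0 v)); lra.
move: phi1; rewrite /phi scale1r scale0r addr0; lra.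
Qed.

End Gradient.

(** * Relative interior of a convex set containing the origin *)

Section RelativeInterior.
Context {R : realType} {d : nat}.
Variable W : set 'rV[R]_d.
Hypotheses (W_convex : convex_set W) (W0 : W 0).

(** The origin takes the missing weight. In the induction the last point is split off and the other
    weights are divided by [1 - a]. *)
Lemma convex_comb n (c : 'I_n -> R) (w : 'I_n -> 'rV[R]_d) :
  (forall i, 0 <= c i) -> \sum_i c i <= 1 -> (forall i, W (w i)) ->
  W (\sum_i c i *: w i).
Proof.
elim: n c w => [|n IH] c w c0 c1 Ww; first by rewrite big_ord0.
rewrite big_ord_recr /=; move: c1; rewrite big_ord_recr /=.
set a := c ord_max; set S := \sum_(i < n) _ => c1.
have S0 : 0 <= S by exact: sumr_ge0.
have a0 : 0 <= a by exact: c0.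
have [a1|aN1] := eqVneq a 1.
  rewrite big1 ?add0r ?a1 ?scale1r // => i _.
  have SE : S = 0 by lra.
  have /eqP := SE; rewrite psumr_eq0 // => /allP /(_ i (mem_index_enum _)) /eqP ->.
  by rewrite scale0r.
have a1 : 0 < 1 - a by rewrite subr_gt0 lt_neqAle aN1; lra.
have -> : \sum_(i < n) c (widen_ord (leqnSn n) i) *: w (widen_ord (leqnSn n) i)
    = (1 - a) *: \sum_(i < n)
        (c (widen_ord (leqnSn n) i) / (1 - a)) *: w (widen_ord (leqnSn n) i).
  rewrite scaler_sumr; apply: eq_bigr => i _.
  by rewrite scalerA mulrC divfK // gt_eqF.
rewrite addrC; apply: convex_setP => //; first by rewrite a0; lra.
apply: IH => // [i|]; first by rewrite divr_ge0 // ltW.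
by rewrite -mulr_suml ler_pdivrMr // mul1r -/S; lra.
Qed.

(** A linearly independent family in [W] of maximal size spans [W]: a point outside its span could
    be appended. *)
Lemma exists_spanning_rows : exists m (A : 'M[R]_(m, d)),
  [/\ row_free A, forall i, W (row i A) & forall w, W w -> (w <= A)%MS].
Proof.
pose p m := `[< exists A : 'M[R]_(m, d), row_free A /\ forall i, W (row i A) >].
have p0 : exists m, p m.
  exists 0%N; apply/asboolP; exists 0; split; last by case.
  by rewrite /row_free mxrank0.
have pd m : p m -> (m <= d)%N.
  by move=> /asboolP [A [/eqP mA _]]; rewrite -mA rank_leq_col.
case: (ex_maxnP p0 pd) => m /asboolP [A [Afree AW]] mmax.
exists m, A; split=> // w Ww.
rewrite -[(w <= A)%MS]negbK; apply/negP => wA.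
suff /mmax : p (1 + m)%N by rewrite ltnn.
apply/asboolP; exists (col_mx w A); split; last first.
  move=> i; case: (split_ordP i) => k ->; last by rewrite rowKd.
  by rewrite rowKu ord1 row_id.
apply: inj_row_free => v; rewrite -[v]hsubmxK mul_row_col.
set a := lsubmx v; set b := rsubmx v.
have [a0|aN0] := eqVneq a 0.
  rewrite a0 mul0mx add0r => /eqP; rewrite mulmx_free_eq0 // => /eqP ->.
  by rewrite row_mx0.
move=> /eqP; rewrite addr_eq0 => /eqP aw; case/negP: wA.
have a00 : a 0 0 != 0.
  by apply: contra aN0 => /eqP a0; apply/eqP/matrixP => i j; rewrite !ord1 a0 mxE.
have -> : w = (- (a 0 0)^-1 *: b) *m A.
  have : a *m w = a 0 0 *: w by rewrite [a]mx11_scalar mul_scalar_mx !mxE.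
  rewrite aw => E; rewrite scaleNr mulNmx -scalemxAl -scalerN E scalerA.
  by rewrite mulVf // scale1r.
exact: submxMl.
Qed.

(* [M] is the orthogonal projection onto the linear span of [W], in which [z0]
   is an interior point of [W]. *)
Lemma exists_relative_interior : exists (M : 'M[R]_d) (z0 : 'rV[R]_d) (r : R),
  [/\ M *m M = M, M^T = M, forall w, W w -> w *m M = w, 0 < r &
      forall v, v *m M = v -> enorm v <= r -> W (z0 + v)].
Proof.
have [m [A [Afree AW WA]]] := exists_spanning_rows.
(* A vector [v] in the kernel of the Gram matrix satisfies [dot (v *m A) (v *m A) = 0]. *)
have gramU : A *m A^T \in unitmx.
  rewrite -row_free_unit; apply: inj_row_free => v vAA.
  apply/eqP; rewrite -(mulmx_free_eq0 _ Afree); apply/eqP/dot_eq0.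
  by rewrite dot_mulmx trmx_mul -mulmxA (mulmxA A) mulmxA vAA mul0mx mxE.
(* For [v] in the row space of [A], [v *m B] is its coordinate vector in the basis of rows. *)
pose B := A^T *m invmx (A *m A^T).
have AB : A *m B = 1%:M by rewrite mulmxA mulmxV.
have BAA w : (w <= A)%MS -> w *m (B *m A) = w.
  by move=> /submxP [c ->]; rewrite mulmxA -(mulmxA c) AB mulmx1.
have m1 : 0 < (m.+1%:R : R) by rewrite ltr0n.
(* The coordinates of [v] have total absolute value at most [enorm v * C]; the summand 1 keeps [C]
   positive. *)
pose C : R := 1 + \sum_j enorm (col j B)^T.
have C0 : 0 < C by rewrite ltr_pwDl // sumr_ge0 // => j _; exact: enorm_ge0.
(* Each of the [m] rows, and implicitly the origin, has weight [m.+1%:R^-1]. The radius keeps the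
   total change of the row weights below this value, so they stay nonnegative with sum at most 1. *)
exists (B *m A), (\sum_i m.+1%:R^-1 *: row i A), (m.+1%:R * C)^-1; split.
- by rewrite mulmxA -(mulmxA B) AB mulmx1.
- by rewrite /B !trmx_mul trmxK trmx_inv trmx_mul trmxK mulmxA.
- by move=> w /WA /BAA.
- by rewrite invr_gt0 mulr_gt0.
move=> v vM vr.
have -> : v = \sum_i (v *m B) 0 i *: row i A.
  by rewrite -mulmx_sum_row -mulmxA.
rewrite -big_split /=.
under eq_bigr do rewrite -scalerDl.
have vB : \sum_i `|(v *m B) 0 i| <= m.+1%:R^-1.
  apply: (@le_trans _ _ (enorm v * C)); last first.
    apply: le_trans (ler_wpM2r (ltW C0) vr) _.
    by rewrite invfM -mulrA mulVf ?mulr1 // gt_eqF.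
  rewrite mulrDr mulr1 mulr_sumr -[leLHS]add0r lerD ?enorm_ge0 //.
  apply: ler_sum => j _.
  have E : (v *m B) 0 j = dot v (col j B)^T.
    by rewrite mxE; apply: eq_bigr => k _; rewrite !mxE.
  rewrite E ler_norml CauchySchwarz_dot andbT -(opprK (dot _ _)) lerN2.
  by rewrite -dotNl -(enormN v) CauchySchwarz_dot.
have vBi i : `|(v *m B) 0 i| <= m.+1%:R^-1.
  by apply: le_trans vB; rewrite (bigD1 i) //= lerDl sumr_ge0.
apply: convex_comb => // [i|].
  by have := vBi i; rewrite ler_norml => /andP[? _]; rewrite -lerBlDl sub0r.
rewrite big_split /= sumr_const card_ord.
have : \sum_i (v *m B) 0 i <= m.+1%:R^-1.
  by apply: le_trans vB; apply: ler_sum => i _; exact: ler_norm.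
have : (m.+1%:R^-1 *+ m + m.+1%:R^-1 : R) = 1.
  by rewrite -mulrSr -[LHS]mulr_natr mulVf // gt_eqF.
by move: (m.+1%:R^-1 : R) (\sum_i _) => a b ab b1; rewrite -ab lerD2l.
Qed.

End RelativeInterior.

(** * Nonexpansiveness of the projected gradient step *)

Section GradientStep.
Context {R : realType} {d : nat}.
Variables (W : set 'rV[R]_d) (f : 'rV[R]_d -> R) (L : R).
Hypotheses (W_convex : convex_set W) (W0 : W 0).
Hypotheses (f_convex : convex_function setT f) (df : forall x, differentiable f x).
Hypothesis L_gt0 : 0 < L.
Hypothesis f_smooth : forall x y, W x -> W y ->
  enorm (grad f x - grad f y) <= L * enorm (x - y).

Section Projected.
Variable M : 'M[R]_d.
Hypotheses (MM : M *m M = M) (MT : M^T = M) (WM : forall w, W w -> w *m M = w).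

Lemma dot_mulmx_sym u v : dot (u *m M) v = dot u (v *m M).
Proof. by rewrite !dot_mulmx trmx_mul MT mulmxA. Qed.

Lemma enorm_mulmx_proj u : enorm (u *m M) <= enorm u.
Proof.
have := CauchySchwarz_dot u (u *m M).
rewrite -{1}MM mulmxA -dot_mulmx_sym -sqr_enorm.
have [->|uN0] := eqVneq (enorm (u *m M)) 0; first by rewrite enorm_ge0.
by rewrite expr2 ler_pM2r // lt_def uN0 enorm_ge0.
Qed.

Lemma sub_mulmx p q : W p -> W q -> (q - p) *m M = q - p.
Proof. by move=> Wp Wq; rewrite mulmxBl !WM. Qed.

(* The Bregman divergence of [f] at [p] is minimal at [p], hence bounded above
   by its decrease along a projected gradient step of length [1/L] from [q]. *)
Lemma bregman_ge p q : W q ->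
  W (q - L^-1 *: ((grad f q - grad f p) *m M)) ->
  f p + dot (grad f p) (q - p)
    + dot ((grad f q - grad f p) *m M) ((grad f q - grad f p) *m M) / (2 * L)
  <= f q.
Proof.
set g := grad f q - grad f p; set D := g *m M => Wq Wq'.
have tangent := convex_ge_tangent (q - L^-1 *: D) f_convex (df p).
have descent : f (q - L^-1 *: D) <=
    f q + dot (grad f q) (- (L^-1 *: D)) + L / 2 * dot (- (L^-1 *: D)) (- (L^-1 *: D)).
  apply: lipschitz_grad_descent => // t t01.
  have Wt : W (q + t *: - (L^-1 *: D)).
    have := convex_setP W_convex t01 Wq' Wq.
    by congr W; apply/rowP => j; rewrite !mxE; ring.
  by have := f_smooth Wt Wq; rewrite [q + _]addrC addrK.
have gD : dot (grad f q) D - dot (grad f p) D = dot D D.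
  by rewrite -dotNl -dotDl -/g dot_mulmx_sym /D -mulmxA MM.
have LE : L / 2 * (L^-1 * (L^-1 * dot D D)) = dot D D / (2 * L).
  by field; rewrite gt_eqF.
have E : L^-1 * dot D D = 2 * (dot D D / (2 * L)) by field; rewrite gt_eqF.
move: tangent descent; rewrite [q - _ - p]addrAC !dotE !opprK LE.
have : L^-1 * (dot (grad f q) D - dot (grad f p) D) = L^-1 * dot D D by rewrite gD.
rewrite E; lra.
Qed.

(** Adding [bregman_ge] in both directions gives cocoercivity of the projected gradient. In the
    expanded square, [a <= 2 / L] then lets the cross term absorb the quadratic one. *)
Lemma grad_step_local (a : R) p q : 0 <= a -> a <= 2 / L -> W p -> W q ->
  (forall v, v *m M = v -> enorm v <= enorm (q - p) -> W (p + v) /\ W (q + v)) ->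
  enorm (((q - a *: grad f q) - (p - a *: grad f p)) *m M) <= enorm (q - p).
Proof.
move=> a0 aL Wp Wq near_pq.
set g := grad f q - grad f p; set D := g *m M.
have DM : D *m M = D by rewrite -mulmxA MM.
(* Both test points of [bregman_ge] thus lie within the reach of [near_pq]. *)
have Dle : enorm (L^-1 *: D) <= enorm (q - p).
  rewrite enormZ gtr0_norm ?invr_gt0 // ler_pdivrMl //.
  by apply: le_trans (enorm_mulmx_proj _) _; exact: f_smooth.
have [Wp' _] := near_pq (L^-1 *: D) ltac:(by rewrite -scalemxAl DM) Dle.
have [_ Wq'] := near_pq (- (L^-1 *: D))
  ltac:(by rewrite mulNmx -scalemxAl DM) ltac:(by rewrite enormN).
have := bregman_ge Wq Wq'.
have : W (p - L^-1 *: ((grad f p - grad f q) *m M)).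
  by rewrite -(opprB (grad f q)) mulNmx scalerN opprK.
move=> /(bregman_ge Wp).
rewrite -(opprB (grad f q)) mulNmx -/g -/D -(opprB q p) !dotE !opprK => H1 H2.
have cocoercive : dot D D / L <= dot D (q - p).
  rewrite [leRHS]dot_mulmx_sym sub_mulmx //.
  have E : dot D D / L = dot D D / (2 * L) + dot D D / (2 * L).
    by field; rewrite gt_eqF.
  by move: H1 H2; rewrite E /g !dotE; lra.
apply: enorm_le; first exact: enorm_ge0.
have -> : ((q - a *: grad f q) - (p - a *: grad f p)) *m M = (q - p) - a *: D.
  rewrite -(sub_mulmx Wp Wq) /D scalemxAl -mulmxBl; congr (_ *m _).
  by apply/rowP => j; rewrite !mxE; ring.
rewrite sqr_enorm (dotBB (q - p)) dotZl !dotZr (dotC (q - p) D).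
have : a * (dot D D / L) <= a * dot D (q - p) by rewrite ler_wpM2l.
have : a * dot D D * a <= a * dot D D * (2 / L).
  by rewrite ler_wpM2l // mulr_ge0 // dot_ge0.
have -> : a * dot D D * (2 / L) = 2 * (a * (dot D D / L)).
  by field; rewrite gt_eqF.
lra.
Qed.

(** The segment is cut into [N] pieces of length at most [r]; [grad_step_local] handles each piece
    and the triangle inequality adds them up. *)
Lemma grad_step_segment (a r : R) p q : 0 <= a -> a <= 2 / L -> 0 < r ->
  (forall t v, 0 <= t <= 1 -> v *m M = v -> enorm v <= r ->
    W (p + t *: (q - p) + v)) ->
  enorm (((q - a *: grad f q) - (p - a *: grad f p)) *m M) <= enorm (q - p).
Proof.
move=> a0 aL r0 near_pq.
have [N [NN Nr]] : exists N : nat, (0 < N)%N /\ enorm (q - p) / N%:R <= r.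
  exists (Num.bound (enorm (q - p) / r)).+1; split=> //.
  rewrite ler_pdivrMr ?ltr0n // mulrC -ler_pdivrMr //.
  apply: le_trans (ltW (archi_boundP _)) _; first by rewrite divr_ge0 ?enorm_ge0 // ltW.
  by rewrite ler_nat.
have Npos : 0 < (N%:R : R) by rewrite ltr0n.
pose x (i : nat) := p + (i%:R / N%:R) *: (q - p).
have xS i : x i.+1 - x i = N%:R^-1 *: (q - p).
  rewrite /x opprD addrACA subrr add0r -scalerBl -mulrBl -natrB // subSnn mul1r //.
have nearx i v : (i <= N)%N -> v *m M = v -> enorm v <= r -> W (x i + v).
  move=> iN vM vr; apply: near_pq => //.
  by rewrite divr_ge0 ?ler0n //= ler_pdivrMr // mul1r ler_nat.
have Wx i : (i <= N)%N -> W (x i).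
  by move=> iN; rewrite -[x i]addr0; apply: nearx; rewrite ?mul0mx ?enorm0 ?ltW.
have stepx i : (i <= N)%N ->
    enorm (((x i - a *: grad f (x i)) - (p - a *: grad f p)) *m M)
    <= i%:R / N%:R * enorm (q - p).
  elim: i => [|i IH] iN.
    by rewrite /x !mul0r scale0r addr0 subrr mul0mx enorm0.
  have dxr : enorm (x i.+1 - x i) <= r.
    by rewrite xS enormZ gtr0_norm ?invr_gt0 // mulrC.
  rewrite -(subrKA (x i - a *: grad f (x i))) mulmxDl.
  apply: le_trans (ler_enormD _ _) _; rewrite -natr1 mulrDl mulrDl addrC.
  apply: lerD; first exact/IH/ltnW.
  have -> : 1 / N%:R * enorm (q - p) = enorm (x i.+1 - x i).
    by rewrite xS enormZ gtr0_norm ?invr_gt0 // mul1r.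
  apply: grad_step_local => //; [exact/Wx/ltnW | exact: Wx |].
  by move=> v vM vle; split; apply: nearx => //;
    [exact: ltnW | exact: le_trans vle dxr | exact: le_trans vle dxr].
have := stepx N (leqnn _).
by rewrite /x divff ?gt_eqF // scale1r mul1r [p + _]addrC subrK.
Qed.

(** Both points are moved by a fraction [t] towards [z0], which gives the new segment room of radius
    [t * r] inside [W]. The error is of order [t], and [t] is arbitrarily small. *)
Lemma grad_step_nonexpansive (a r : R) z0 p q : 0 <= a -> a <= 2 / L -> 0 < r ->
  (forall v, v *m M = v -> enorm v <= r -> W (z0 + v)) -> W p -> W q ->
  enorm (((q - a *: grad f q) - (p - a *: grad f p)) *m M) <= enorm (q - p).
Proof.
move=> a0 aL r0 z0r Wp Wq.
have Wz0 : W z0.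
  by rewrite -[z0]addr0; apply: z0r; rewrite ?mul0mx ?enorm0 ?ltW.
pose sh (t : R) x := t *: z0 + (1 - t) *: x.
pose T x := x - a *: grad f x.
have Tsh t x : 0 < t -> t <= 1 -> W x ->
    enorm ((T x - T (sh t x)) *m M) <= t * ((1 + a * L) * enorm (x - z0)).
  move=> t0 t1 Wx; apply: le_trans (enorm_mulmx_proj _) _.
  have Wsh : W (sh t x) by apply: convex_setP => //; rewrite ltW.
  have -> : T x - T (sh t x)
      = (x - sh t x) - a *: (grad f x - grad f (sh t x)).
    by apply/rowP => j; rewrite !mxE; ring.
  apply: le_trans (ler_enormB _ _) _.
  rewrite enormZ ger0_norm //.
  have := ler_wpM2l a0 (f_smooth Wx Wsh).
  have -> : x - sh t x = t *: (x - z0).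
    by apply/rowP => j; rewrite !mxE; ring.
  by rewrite enormZ gtr0_norm //; lra.
set C := (1 + a * L) * enorm (q - z0) + (1 + a * L) * enorm (p - z0).
have C0 : 0 <= C.
  by rewrite addr_ge0 // mulr_ge0 ?enorm_ge0 // addr_ge0 // mulr_ge0 // ltW.
suff bound t : 0 < t -> t <= 1 ->
    enorm ((T q - T p) *m M) <= enorm (q - p) + t * C.
  rewrite leNgt; apply/negP => lt_qp.
  set e := enorm ((T q - T p) *m M) - enorm (q - p).
  have e0 : 0 < e by rewrite subr_gt0.
  have eC : 0 < e + C by rewrite ltr_wpDr.
  have t1 : e / (e + C + 1) <= 1 by rewrite ler_pdivrMr; lra.
  (* With this [t], [bound] yields [e * (e + C + 1) <= e * C], impossible for [e > 0]. *)
  have := bound (e / (e + C + 1)).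
  rewrite divr_gt0 //; last by lra.
  move=> /(_ isT t1); rewrite -lerBlDl -/e mulrAC ler_pdivlMr; last by lra.
  have := mulr_gt0 e0 e0; lra.
move=> t0 t1.
have -> : T q - T p = (T q - T (sh t q)) - (T p - T (sh t p))
    + (T (sh t q) - T (sh t p)).
  by apply/rowP => j; rewrite !mxE; ring.
rewrite mulmxDl mulmxBl; apply: le_trans (ler_enormD _ _) _; rewrite addrC.
apply: lerD; last first.
  by apply: le_trans (ler_enormB _ _) _; rewrite mulrDr lerD // Tsh.
apply: (@le_trans _ _ (enorm (sh t q - sh t p))); last first.
  have -> : sh t q - sh t p = (1 - t) *: (q - p).
    by apply/rowP => j; rewrite !mxE; ring.
  rewrite enormZ ger0_norm ?subr_ge0 //.
  by have := enorm_ge0 (q - p); nra.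
apply: (@grad_step_segment a (t * r)) => //; first exact: mulr_gt0.
move=> s v s01 vM vr.
(* The whole perturbation [v] is charged to the [z0] component, where it is scaled by [t^-1] and
   still has length at most [r]. *)
have -> : sh t p + s *: (sh t q - sh t p) + v
    = t *: (z0 + t^-1 *: v) + (1 - t) *: (s *: q + (1 - s) *: p).
  rewrite [t *: (_ + _)]scalerDr scalerA divff ?gt_eqF // scale1r.
  by apply/rowP => j; rewrite !mxE; ring.
apply: convex_setP => //; first by rewrite ltW.
  apply: z0r; first by rewrite -scalemxAl vM.
  by rewrite enormZ gtr0_norm ?invr_gt0 // ler_pdivrMl.
exact: convex_setP.
Qed.

End Projected.

(** Firm nonexpansiveness involves the gradient steps only through their product with [p - q]. This
    vector is fixed by [M], so [M] can be moved onto the steps. *)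
Lemma proj_grad_step_nonexpansive (a : R) x y p q : 0 <= a -> a <= 2 / L ->
  W x -> W y ->
  is_proj W (x - a *: grad f x) p -> is_proj W (y - a *: grad f y) q ->
  enorm (p - q) <= enorm (x - y).
Proof.
move=> a0 aL Wx Wy xp yq.
have [M [z0 [r [MM MT WM r0 z0r]]]] := exists_relative_interior W_convex W0.
have := is_proj_firmly_nonexpansive W_convex xp yq.
rewrite -{3}(sub_mulmx WM (proj1 yq) (proj1 xp)) -(dot_mulmx_sym MT) -sqr_enorm.
move=> /le_trans /(_ (CauchySchwarz_dot _ _)); rewrite expr2.
have step := grad_step_nonexpansive MM MT WM a0 aL r0 z0r Wy Wx.
have [->|pqN0] := eqVneq (enorm (p - q)) 0; first by rewrite enorm_ge0.
rewrite ler_pM2r ?lt_def ?pqN0 ?enorm_ge0 // => /le_trans; exact.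
Qed.
End GradientStep.

(** * Finite sums and Jensen's inequality *)

Lemma sum_const {R : pzRingType} (I : finType) (x : R) :
  \sum_(i : I) x = #|I|%:R * x.
Proof. by rewrite sumr_const mulr_natl. Qed.

(** Sum of the tangent inequalities at the mean, whose linear terms cancel. *)
Lemma convex_average_le {R : realType} {d : nat} (I : finType)
    (f : 'rV[R]_d -> R) (x : I -> 'rV[R]_d) :
  (0 < #|I|)%N -> convex_function setT f -> (forall z, differentiable f z) ->
  #|I|%:R * f (#|I|%:R^-1 *: \sum_i x i) <= \sum_i f (x i).
Proof.
move=> I0 fc df; set xm := _ *: _.
have : \sum_i (f xm + dot (grad f xm) (x i - xm)) <= \sum_i f (x i).
  by apply: ler_sum => i _; exact: convex_ge_tangent.
rewrite big_split /= -dot_sumr sumrB !sumr_const cardT -cardE.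
rewrite -[xm *+ _]scaler_nat scalerA divff ?pnatr_eq0 -?lt0n // scale1r subrr.
by rewrite dotC dot0l addr0 mulr_natl.
Qed.

(** * Analysis of SGD without replacement *)

Section SGDWithoutReplacement.
Context {R : realType} {d n K : nat}.
Variables (W : set 'rV[R]_d) (f : 'I_n -> 'rV[R]_d -> R) (G L a : R).
Hypotheses (W_convex : convex_set W) (W0 : W 0).
Hypothesis W_proj : forall x, is_proj W x (Defs.proj W x).
Hypothesis f_convex : forall i, convex_function setT (f i).
Hypothesis df : forall i x, differentiable (f i) x.
Hypothesis grad_bounded : forall i x, W x -> enorm (grad (f i) x) <= G.
Hypothesis grad_lipschitz : forall i x y, W x -> W y ->
  enorm (grad (f i) x - grad (f i) y) <= L * enorm (x - y).
Hypotheses (L_gt0 : 0 < L) (a_ge0 : 0 <= a) (a_le : a <= 2 / L).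
Implicit Types (s : 'S_n) (sigma : {ffun 'I_K -> 'S_n}).

Local Notation epoch := (sgd_epoch W f (fun _ => a)).
Local Notation start := (sgd_start W f (fun _ _ => a)).
Local Notation iter := (sgd_iter W f (fun _ _ => a)).
Local Notation step i x := (Defs.proj W (x - a *: grad (f i) x)).

Lemma sgd_epochS s x (i : 'I_n) :
  epoch s x i.+1 = step (s i) (epoch s x i).
Proof. by rewrite /= valK. Qed.

Lemma sgd_epoch_in s x i : W x -> W (epoch s x i).
Proof.
move=> Wx; elim: i => //= i IH.
by case: insubP => // j _ _; exact: (W_proj _).1.
Qed.

Lemma sgd_start_in sigma k : W (start sigma k).
Proof.
elim: k => //= k IH.
by case: insubP => // l _ _; exact: sgd_epoch_in.
Qed.

Lemma sgd_iter_in sigma (k : 'I_K) i : W (iter sigma k i).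
Proof. exact/sgd_epoch_in/sgd_start_in. Qed.

(** Ensures that a swap within epoch [k] does not alter the point where that epoch starts. *)
Lemma eq_sgd_start sigma sigma' (k : nat) :
  (forall l : 'I_K, (l < k)%N -> sigma l = sigma' l) ->
  start sigma k = start sigma' k.
Proof.
elim: k => //= k IH eqs; rewrite IH; last by move=> l lk; apply/eqs/ltnW.
by case: insubP => // l _ lk; rewrite eqs // lk.
Qed.

(** By the tangent inequality at [x], the gradient bound at this one point suffices. *)
Lemma component_lipschitz r x y : W x -> f r x - f r y <= G * enorm (x - y).
Proof.
move=> Wx; have := convex_ge_tangent y (@f_convex r) (df r x).
rewrite -[y - x]opprB dotNr.
have := CauchySchwarz_dot (grad (f r) x) (x - y).
have := ler_wpM2r (enorm_ge0 (x - y)) (grad_bounded r Wx); lra.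
Qed.

Lemma grad_bound_ge0 (r : 'I_n) : 0 <= G.
Proof. exact: le_trans (enorm_ge0 _) (grad_bounded r W0). Qed.

(* The two runs agree until position [j]; there they separate by at most [2aG],
   and the later steps before position [i] are common to both runs. *)
Lemma sgd_epoch_swap s x (i j : 'I_n) m : W x -> (m <= i)%N ->
  enorm (epoch (tperm i j * s)%g x m - epoch s x m) <= (j < m)%:R * (2 * a * G).
Proof.
move=> Wx; elim: m => [|m IH] mi; first by rewrite subrr enorm0 mul0r.
have {IH} := IH (ltnW mi).
have mn : (m < n)%N := ltn_trans mi (ltn_ord i).
rewrite -[m]/(nat_of_ord (Ordinal mn)) !sgd_epochS permM.
move: (epoch _ x _) (epoch s x _) (sgd_epoch_in (tperm i j * s)%g (Ordinal mn) Wx)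
  (sgd_epoch_in s (Ordinal mn) Wx) => y z Wy Wz.
have [jm|jm] := eqVneq j (Ordinal mn).
  rewrite jm ltnn mul0r => /enorm_eq0/eqP; rewrite subr_eq0 => /eqP ->.
  rewrite ltnSn mul1r; apply: le_trans (is_proj_nonexpansive W_convex
    (W_proj _) (W_proj _)) _.
  rewrite opprB addrC subrKA.
  apply: le_trans (ler_enormB _ _) _; rewrite !enormZ ger0_norm //.
  have := ler_wpM2l a_ge0 (grad_bounded (s (tperm i (Ordinal mn) (Ordinal mn))) Wz).
  have := ler_wpM2l a_ge0 (grad_bounded (s (Ordinal mn)) Wz); lra.
rewrite tpermD //; last by rewrite -val_eqE /= gtn_eqF.
rewrite ltnS [(j <= m)%N]leq_eqVlt; move: (jm); rewrite -val_eqE /= => /negPf -> /=.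
apply: le_trans; exact: (proj_grad_step_nonexpansive W_convex W0
  (@f_convex _) (df _) L_gt0 (@grad_lipschitz _) a_ge0 a_le Wy Wz (W_proj _)
  (W_proj _)).
Qed.

(** The left factor of a product of permutations acts first, so positions are exchanged rather than
    components. *)
Definition swap_at (k : 'I_K) (i j : 'I_n) sigma : {ffun 'I_K -> 'S_n} :=
  [ffun l => if l == k then (tperm i j * sigma k)%g else sigma l].

Lemma swap_atK k i j : involutive (swap_at k i j).
Proof.
move=> sigma; apply/ffunP => l; rewrite !ffunE eqxx; case: eqP => // ->.
by rewrite mulgA tperm2 mul1g.
Qed.

Lemma sgd_iter_swap sigma (k : 'I_K) (i j : 'I_n) :
  enorm (iter (swap_at k i j sigma) k i - iter sigma k i) <= 2 * a * G.
Proof.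
rewrite /sgd_iter (@eq_sgd_start _ sigma) => [|l lk]; last first.
  by rewrite ffunE -val_eqE ltn_eqF.
rewrite ffunE eqxx; apply: le_trans (sgd_epoch_swap _ _ (sgd_start_in _ _) _) _ => //.
by case: (j < i)%N; rewrite ?mul1r ?mul0r // !mulr_ge0 // (grad_bound_ge0 i).
Qed.

(* Exchanging positions [i] and [j] in epoch [k] preserves the distribution and
   puts an arbitrary component at position [i]. *)
Lemma sum_avg_obj_iter_le (k : 'I_K) (i : 'I_n) :
  \sum_(sigma : {ffun 'I_K -> 'S_n}) avg_obj f (iter sigma k i) <=
  \sum_(sigma : {ffun 'I_K -> 'S_n}) (f (sigma k i) (iter sigma k i) + 2 * a * G ^+ 2).
Proof.
have n0 : (0 < n)%N := leq_ltn_trans (leq0n i) (ltn_ord i).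
rewrite /avg_obj -mulr_sumr ler_pdivrMl ?ltr0n //.
have -> : \sum_(sigma : {ffun 'I_K -> 'S_n}) \sum_r f r (iter sigma k i)
    = \sum_(j < n) \sum_(sigma : {ffun 'I_K -> 'S_n})
        f (sigma k i) (iter (swap_at k i j sigma) k i).
  (* Components are indexed by their position [j]; for each [j], the involution [swap_at k i j] then
     reindexes the permutations. *)
  under eq_bigr => sigma _ do rewrite (reindex_inj (@perm_inj _ (sigma k))) /=.
  rewrite exchange_big /=; apply: eq_bigr => j _.
  rewrite (reindex_inj (inv_inj (swap_atK k i j))) /=.
  by apply: eq_bigr => sigma _; rewrite ffunE eqxx permM tpermR.
rewrite -[n in n%:R]card_ord -sum_const.
apply: ler_sum => j _; apply: ler_sum => sigma _; rewrite -lerBlDl.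
apply: le_trans (component_lipschitz _ _ (sgd_iter_in _ _ _)) _.
have := ler_wpM2l (grad_bound_ge0 i) (sgd_iter_swap sigma k i j); lra.
Qed.

Section Descent.
Variables (z : 'rV[R]_d) (Wz : W z).

(** The projection fixes [z] and is nonexpansive; expand the squared distance and bound the cross
    term by the tangent inequality. *)
Lemma grad_step_dist r x : W x ->
  2 * a * (f r x - f r z) <=
  enorm (x - z) ^+ 2 - enorm (step r x - z) ^+ 2 + a ^+ 2 * G ^+ 2.
Proof.
move=> Wx.
have zz : is_proj W z z by split=> // y _; rewrite subrr enorm0 enorm_ge0.
have := is_proj_nonexpansive W_convex (W_proj (x - a *: grad (f r) x)) zz.
rewrite -ler_sqr ?nnegrE ?enorm_ge0 // addrAC [in leRHS]sqr_enorm.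
rewrite (dotBB (x - z)) dotZl !dotZr -!sqr_enorm => dist.
have := ler_wpM2l a_ge0 (convex_ge_tangent z (@f_convex r) (df r x)).
rewrite -[z - x]opprB dotNr (dotC (grad _ _)) => tangent.
have : a ^+ 2 * enorm (grad (f r) x) ^+ 2 <= a ^+ 2 * G ^+ 2.
  by rewrite ler_wpM2l ?sqr_ge0 // ler_sqr ?nnegrE ?enorm_ge0
    ?(grad_bound_ge0 r) ?grad_bounded.
lra.
Qed.

(** The distances telescope, and the comparison sum at [z] does not depend on [s] because an epoch
    visits each component once. *)
Lemma sgd_epoch_dist s x : W x ->
  2 * a * (\sum_(i < n) f (s i) (epoch s x i) - \sum_(i < n) f i z) <=
  enorm (x - z) ^+ 2 - enorm (epoch s x n - z) ^+ 2 + n%:R * (a ^+ 2 * G ^+ 2).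
Proof.
move=> Wx; pose u i := enorm (epoch s x i - z) ^+ 2.
rewrite [X in _ - X](reindex_inj (@perm_inj _ s)) /= -sumrB mulr_sumr.
have -> : enorm (x - z) ^+ 2 - enorm (epoch s x n - z) ^+ 2
    = \sum_(i < n) (u i - u i.+1).
  rewrite -(big_mkord xpredT (fun i => u i - u i.+1)).
  rewrite -[LHS]opprB -(telescope_sumr u (leq0n n)) -sumrN.
  by apply: eq_bigr => i _; rewrite opprB.
rewrite -[X in _ + X%:R * _]card_ord -sum_const -big_split /=.
apply: ler_sum => i _; rewrite /u sgd_epochS.
exact/grad_step_dist/sgd_epoch_in.
Qed.

Lemma sgd_dist sigma :
  2 * a * (\sum_(k < K) \sum_(i < n) f (sigma k i) (iter sigma k i)
    - K%:R * \sum_(i < n) f i z) <=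
  enorm z ^+ 2 + K%:R * (n%:R * (a ^+ 2 * G ^+ 2)).
Proof.
pose u k := enorm (start sigma k - z) ^+ 2.
apply: (@le_trans _ _ (\sum_(k < K) (u k - u k.+1 + n%:R * (a ^+ 2 * G ^+ 2)))).
  rewrite -[X in _ - X%:R * _]card_ord -sum_const -sumrB mulr_sumr.
  apply: ler_sum => k _; rewrite /u /= valK.
  exact/sgd_epoch_dist/sgd_start_in.
rewrite big_split /= sum_const card_ord lerD2r.
rewrite -(big_mkord xpredT (fun i => u i - u i.+1)).
have -> : \sum_(0 <= k < K) (u k - u k.+1) = u 0%N - u K.
  rewrite -[RHS]opprB -(telescope_sumr u (leq0n K)) -sumrN.
  by apply: eq_bigr => i _; rewrite opprB.
by rewrite /u /= sub0r enormN gerBl sqr_ge0.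
Qed.

End Descent.

Lemma sgd_average_le sigma : (0 < K)%N -> (0 < n)%N ->
  (K * n)%:R * avg_obj f (sgd_average W f (fun _ _ => a) sigma) <=
  \sum_(k < K) \sum_(i < n) avg_obj f (iter sigma k i).
Proof.
move=> K0 n0; set xm := sgd_average _ _ _ _.
(* Indexing by pairs turns the average into a single mean, to which Jensen's inequality applies for
   each component. *)
have xmE : xm = #|{: 'I_K * 'I_n}|%:R^-1 *: \sum_(p : 'I_K * 'I_n) iter sigma p.1 p.2.
  by rewrite card_prod !card_ord
    -(pair_bigA _ (fun k (i : 'I_n) => iter sigma k i)) exchange_big.
rewrite pair_bigA /= /avg_obj -mulr_sumr mulrCA ler_wpM2l // mulr_sumr exchange_big.
apply: ler_sum => r _; rewrite xmE.
have {1}-> : (K * n)%N = #|{: 'I_K * 'I_n}| by rewrite card_prod !card_ord.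
by apply: convex_average_le => //; rewrite card_prod !card_ord muln_gt0 K0.
Qed.

(** The factor 5 is 1 from the squared gradients in [sgd_dist] plus 4 from the exchange cost
    [2 * a * G ^+ 2] multiplied by [2 * a]. *)
Lemma expect_sgd_average_le z (D : R) : (0 < K)%N -> (0 < n)%N -> W z -> enorm z <= D ->
  2 * a * (K * n)%:R * (expect_perms (fun sigma =>
      avg_obj f (sgd_average W f (fun _ _ => a) sigma)) - avg_obj f z)
  <= D ^+ 2 + 5 * (K * n)%:R * (a ^+ 2 * G ^+ 2).
Proof.
move=> K0 n0 Wz zD.
pose N : R := #|{: {ffun 'I_K -> 'S_n}}|%:R.
have N0 : 0 < N.
  by rewrite ltr0n; apply/card_gt0P; exists [ffun=> 1%g].
pose S := \sum_(sigma : {ffun 'I_K -> 'S_n})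
  avg_obj f (sgd_average W f (fun _ _ => a) sigma).
pose T := \sum_(sigma : {ffun 'I_K -> 'S_n}) \sum_(k < K)
  \sum_(i < n) f (sigma k i) (iter sigma k i).
have ST : (K * n)%:R * S <= T + N * ((K * n)%:R * (2 * a * G ^+ 2)).
  apply: (@le_trans _ _ (\sum_(s : {ffun 'I_K -> 'S_n})
      \sum_(k < K) \sum_(i < n) avg_obj f (iter s k i))).
    by rewrite mulr_sumr; apply: ler_sum => s _; exact: sgd_average_le.
  rewrite exchange_big /=; under eq_bigr do rewrite exchange_big.
  apply: (@le_trans _ _ (\sum_(k < K) \sum_(i < n) \sum_(s : {ffun 'I_K -> 'S_n})
      (f (s k i) (iter s k i) + 2 * a * G ^+ 2))).
    by apply: ler_sum => k _; apply: ler_sum => i _; exact: sum_avg_obj_iter_le.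
  rewrite le_eqVlt; apply/orP; left; apply/eqP.
  transitivity (\sum_(k < K) \sum_(i < n) (\sum_(s : {ffun 'I_K -> 'S_n})
      f (s k i) (iter s k i) + N * (2 * a * G ^+ 2))).
    by apply: eq_bigr => k _; apply: eq_bigr => i _; rewrite big_split /= sum_const.
  under eq_bigr do rewrite big_split /= sum_const card_ord.
  rewrite big_split /= sum_const card_ord; congr (_ + _).
    by under eq_bigr do rewrite exchange_big; rewrite exchange_big.
  by rewrite natrM; ring.
have TD : 2 * a * (T - N * ((K * n)%:R * avg_obj f z)) <=
    N * (D ^+ 2 + (K * n)%:R * (a ^+ 2 * G ^+ 2)).
  have -> : (K * n)%:R * avg_obj f z = K%:R * \sum_(i < n) f i z.
    by rewrite natrM -mulrA mulVKf // pnatr_eq0 -lt0n.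
  rewrite -!sum_const -sumrB mulr_sumr.
  apply: ler_sum => s _; apply: le_trans (sgd_dist Wz s) _.
  by rewrite natrM mulrA lerD2r ler_sqr ?nnegrE ?(le_trans _ zD) ?enorm_ge0.
have -> : expect_perms (fun sigma => avg_obj f (sgd_average W f (fun _ _ => a) sigma))
    = S / N by [].
rewrite -(ler_pM2l N0).
have -> : N * (2 * a * (K * n)%:R * (S / N - avg_obj f z))
    = 2 * a * ((K * n)%:R * S) - 2 * a * (N * ((K * n)%:R * avg_obj f z)).
  by field; rewrite gt_eqF.
have := ler_wpM2l (mulr_ge0 (ler0n R 2) a_ge0) ST; move: TD.
move: (K * n)%:R (avg_obj f z) => m F; lra.
Qed.

End SGDWithoutReplacement.

(** * The final bound, for the chosen step size *)

Theorem theorem3 (R : realType) (d n K : nat)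
    (n_gt0 : (0 < n)%N) (K_gt0 : (0 < K)%N)
    (W : set 'rV[R]_d) (W_closed : closed W) (W_convex : convex_set W)
    (W0 : W 0)
    (f : 'I_n -> 'rV[R]_d -> R)
    (f_convex : forall i, convex_function setT (f i))
    (f_twice : forall i, twice_differentiable (f i))
    (G L D : R) (G_gt0 : 0 < G) (L_gt0 : 0 < L)
    (grad_bounded : forall i x, W x -> enorm (grad (f i) x) <= G)
    (grad_lipschitz : forall i x y, W x -> W y ->
       enorm (grad (f i) x - grad (f i) y) <= L * enorm (x - y))
    (W_diam : (diam W <= D%:E)%E)
    (xstar : 'rV[R]_d) (xstar_min : minimizer_on W (avg_obj f) xstar) :
  let alpha : R := Num.min (2 / L) (D / (G * Num.sqrt (K * n)%:R)) in
  expect_perms (fun sigma : {ffun 'I_K -> 'S_n} =>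
      avg_obj f (sgd_average W f (fun _ _ => alpha) sigma))
    - avg_obj f xstar
  <= D ^+ 2 * L / (4 * n%:R * K%:R) + 3 * G * D / Num.sqrt (n * K)%:R.
Proof.
have WP x : is_proj W x (Defs.proj W x).
  by apply: is_proj_proj W_diam => //; exists 0.
have df i x : differentiable (f i) x := (f_twice i).1 x.
have Wxs := xstar_min.1.
have xsD : enorm xstar <= D by rewrite -[xstar]subr0 (enorm_le_diam W_diam).
have D_ge0 : 0 <= D := le_trans (enorm_ge0 _) xsD.
cbv zeta; set alpha : R := Num.min _ _; rewrite [(n * K)%N]mulnC.
have m_gt0 : 0 < (K * n)%:R :> R by rewrite ltr0n muln_gt0 K_gt0.
pose q : R := Num.sqrt (K * n)%:R.
have q_gt0 : 0 < q by rewrite sqrtr_gt0.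
have qq : (K * n)%:R = q ^+ 2 by rewrite sqr_sqrtr // ltW.
have mE : 4 * n%:R * K%:R = 4 * q ^+ 2 :> R by rewrite -qq natrM mulrAC mulrA.
have L2 : 0 < 2 / L by rewrite divr_gt0.
have Gq : 0 < G * q by rewrite mulr_gt0.
have alpha_le : alpha <= 2 / L by rewrite /alpha ge_min lexx.
(* For [D = 0] the step size vanishes and cannot be divided by; here [W] is reduced to the origin
   and the gap is 0. *)
have [D0|D_neq0] := eqVneq D 0.
  have W_eq0 x : W x -> x = 0.
    by move=> Wx; apply: enorm_eq0; rewrite -D0 -[x]subr0 (enorm_le_diam W_diam).
  rewrite D0 expr0n /= !mul0r mulr0 mul0r addr0 subr_le0 (W_eq0 _ Wxs).
  rewrite /expect_perms (eq_bigr (fun=> avg_obj f 0)) => [|sigma _]; last first.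
    rewrite /sgd_average big1 ?scaler0 // => i _; apply: big1 => k _.
    exact/W_eq0/(sgd_iter_in _ _ W0 WP).
  rewrite sum_const mulrAC divff ?mul1r // pnatr_eq0 -lt0n.
  by apply/card_gt0P; exists [ffun=> 1%g].
have D_gt0 : 0 < D by rewrite lt_def D_neq0.
have alpha_gt0 : 0 < alpha by rewrite lt_min L2 divr_gt0.
have alpha_leD : alpha <= D / (G * q) by rewrite /alpha ge_min lexx orbT.
have := expect_sgd_average_le W_convex W0 WP f_convex df grad_bounded
  grad_lipschitz L_gt0 (ltW alpha_gt0) alpha_le K_gt0 n_gt0 Wxs xsD.
set gap := _ - _; rewrite mE -/q qq => gap_le.
have {gap_le} : gap <= D ^+ 2 / (2 * q ^+ 2) * alpha^-1 + 5 / 2 * G ^+ 2 * alpha.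
  have c0 : 0 < 2 * alpha * q ^+ 2 by rewrite !mulr_gt0 // exprn_gt0.
  rewrite -(ler_pM2l c0); apply: le_trans gap_le _.
  by rewrite le_eqVlt; apply/orP; left; apply/eqP; field; rewrite !gt_eqF.
move=> /le_trans; apply.
(* The inverse of a minimum is the maximum of the inverses, hence at most their sum. *)
have alphaV : alpha^-1 <= L / 2 + G * q / D.
  have t1 : 0 <= L / 2 by rewrite divr_ge0 // ltW.
  have t2 : 0 <= G * q / D by rewrite divr_ge0 // ltW.
  by rewrite /alpha /Num.min; case: ifP => _; rewrite invf_div -/q; lra.
have : D ^+ 2 / (2 * q ^+ 2) * alpha^-1 <= D ^+ 2 / (2 * q ^+ 2) * (L / 2 + G * q / D).
  by rewrite ler_wpM2l // divr_ge0 ?sqr_ge0 // mulr_ge0 ?sqr_ge0.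
have : 5 / 2 * G ^+ 2 * alpha <= 5 / 2 * G ^+ 2 * (D / (G * q)).
  by rewrite ler_wpM2l // mulr_ge0 ?sqr_ge0 // divr_ge0.
have -> : 5 / 2 * G ^+ 2 * (D / (G * q)) = 5 / 2 * (G * D / q).
  by field; rewrite !gt_eqF.
(* The coefficient 1/2 here and the 5/2 above add up to the constant 3. *)
have -> : D ^+ 2 / (2 * q ^+ 2) * (L / 2 + G * q / D)
    = D ^+ 2 * L / (4 * q ^+ 2) + 1 / 2 * (G * D / q).
  by field; rewrite !gt_eqF.
have -> : 3 * G * D / q = 3 * (G * D / q) by rewrite -!mulrA.
lra.
Qed.
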